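(* Let $d\ge2$, let $n,n'$ be integers with $0<n'\le n$, let $x_1,\dots,x_m\in\mathbb{S}^d$ and $w_1,\dots,w_m>0$. Assume that for some $\eta\in[0,1)$ $$\left|\sum_{j=1}^m w_j\chi(x_j)^2-\int_{\mathbb{S}^d}\chi^2\,\mathrm{d}\omega_d\right|\le \eta\int_{\mathbb{S}^d}\chi^2\,\mathrm{d}\omega_d\qquad\text{for all }\chi\in\mathbb{P}_n(\mathbb{S}^d),$$ and that the quadrature rule has exactness degree $n+n'$, i.e. $\sum_{j=1}^mw_jg(x_j)=\int_{\mathbb{S}^d}g\,\mathrm{d}\omega_d$ for all $g\in\mathbb{P}_{n+n'}(\mathbb{S}^d)$. Then for every $f\in\mathcal{C}(\mathbb{S}^d)$, $$\|\mathcal{U}_nf-f\|_{L^2}\le\left(\sqrt{1+\eta}+1\right)|\mathbb{S}^d|^{1/2}E_{n'}(f),$$ where $E_{n'}(f)=\inf_{\chi\in\mathbb{P}_{n'}(\mathbb{S}^d)}\|f-\chi\|_\infty$.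
   Context: $\mathbb{S}^d$ is the unit sphere in $\mathbb{R}^{d+1}$, $\omega_d$ its (unnormalized) surface measure, $|\mathbb{S}^d|=\int_{\mathbb{S}^d}\mathrm{d}\omega_d$. $\mathcal{C}(\mathbb{S}^d)$ is the space of real-valued continuous functions with uniform norm $\|\cdot\|_\infty$; $\|\cdot\|_{L^2}$ is the norm of real $L^2(\mathbb{S}^d,\omega_d)$. $\mathbb{P}_n(\mathbb{S}^d)$ is the space of restrictions to $\mathbb{S}^d$ of real polynomials on $\mathbb{R}^{d+1}$ of degree at most $n$. For each $\ell\ge 0$, $\{Y_{\ell,k}:k=1,\dots,Z(d,\ell)\}$ is an $L^2$-orthonormal basis of the real spherical harmonics of exact degree $\ell$, $Z(d,\ell)$ being the dimension of that space. Put $\langle f,g\rangle_m=\sum_{j=1}^m w_jf(x_j)g(x_j)$. The unfettered hyperinterpolant of $f$ is $\mathcal{U}_nf=\sum_{\ell=0}^n\sum_{k=1}^{Z(d,\ell)}\langle f,Y_{\ell,k}\rangle_mY_{\ell,k}$. *)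

(* Defs.v *)
From HB Require Import structures.
From mathcomp Require Import all_boot all_order all_algebra.
(* The notations of multinomials clash with those of analysis. *)
From mathcomp Require mpoly.
Import -(notations) mpoly.
From mathcomp Require Import all_classical all_reals all_analysis.
From mathcomp Require Import measurable_realfun.

Set Implicit Arguments.
Unset Strict Implicit.
Unset Printing Implicit Defensive.

Import Order.TTheory GRing.Theory Num.Theory.
Import numFieldNormedType.Exports.

Local Open Scope classical_set_scope.
Local Open Scope ring_scope.

Fact rowv_display : measure_display. Proof. exact: default_measure_display. Qed.

(* The product sigma-algebra on 'rV[R]_n, i.e. its Borel sigma-algebra, by the
   same construction as the library's instance on tuples. *)
Section rowv_measurable.
Variables (R : realType) (n : nat).

Let coors : 'I_n -> 'rV[R]_n -> measurableTypeR R := fun i x => x ord0 i.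

Let rowv_set0 : g_sigma_preimage coors set0.
Proof. exact: sigma_algebra0. Qed.

Let rowv_setC A : g_sigma_preimage coors A -> g_sigma_preimage coors (~` A).
Proof. exact: sigma_algebraC. Qed.

Let rowv_bigcup (F : (set 'rV[R]_n)^nat) :
  (forall i, g_sigma_preimage coors (F i)) ->
  g_sigma_preimage coors (\bigcup_i (F i)).
Proof. exact: sigma_algebra_bigcup. Qed.

HB.instance Definition _ := @isMeasurable.Build rowv_display
  'rV[R]_n (g_sigma_preimage coors) rowv_set0 rowv_setC rowv_bigcup.

Lemma measurable_coor (i : 'I_n) :
  measurable_fun [set: 'rV[R]_n] (fun x => x ord0 i : measurableTypeR R).
Proof.
move=> _ Y mY; rewrite setTI; apply: sub_sigma_algebra => /=.
rewrite -bigcup_seq/=; exists i => /=; first by rewrite mem_index_enum.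
by exists Y => //; rewrite setTI.
Qed.

Lemma measurable_fun_rowvP d (T : measurableType d) (f : T -> 'rV[R]_n) :
  measurable_fun [set: T] f <->
  forall i, measurable_fun [set: T] (fun t => f t ord0 i : measurableTypeR R).
Proof.
split=> [mf i|mf].
  exact: (measurableT_comp (measurable_coor i) mf).
suff H : g_sigma_preimage (fun i => coors i \o f) `<=` measurable.
  rewrite g_sigma_preimage_comp in H => _ A mA; apply: H.
  by exists A.
apply: smallest_sub; first exact: sigma_algebra_measurable.
rewrite -bigcup_seq => A [i _ [B mB <-]].
exact: mf.
Qed.

End rowv_measurable.

Section lebesgue_rowv.
Variable R : realType.

Section step.
Variable n : nat.

Definition consrv (p : measurableTypeR R * 'rV[R]_n) : 'rV[R]_n.+1 :=
  row_mx (p.1)%:M p.2.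

Lemma measurable_consrv : measurable_fun setT consrv.
Proof.
apply/measurable_fun_rowvP => i.
rewrite /consrv; case: (split_ordP (i : 'I_(1 + n))) => j ->.
  rewrite (_ : (fun t => _) = fst); first exact: measurable_fst.
  by apply/funext => -[a b]; rewrite [LHS]row_mxEl (ord1 j) mxE eqxx mulr1n.
rewrite (_ : (fun t => _) = (fun x : 'rV[R]_n => x ord0 j) \o snd).
  exact: (measurableT_comp (measurable_coor j) measurable_snd).
by apply/funext => -[a b]; rewrite [LHS]row_mxEr.
Qed.

Definition unconsrv (x : 'rV[R]_n.+1) : measurableTypeR R * 'rV[R]_n :=
  (x ord0 ord0, \row_j x ord0 (lift ord0 j)).

Lemma consrvK : cancel consrv unconsrv.
Proof.
move=> [a b]; rewrite /unconsrv /consrv /=; congr pair.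
  rewrite (_ : ord0 = lshift n (ord0 : 'I_1)); last exact: val_inj.
  by rewrite [LHS]row_mxEl mxE eqxx mulr1n.
apply/rowP => j; rewrite mxE.
rewrite (_ : lift ord0 j = rshift 1 j); last exact: val_inj.
by rewrite [LHS]row_mxEr.
Qed.

Lemma measurable_unconsrv : measurable_fun setT unconsrv.
Proof.
apply/measurable_fun_pairP; split; first exact: measurable_coor.
apply/measurable_fun_rowvP => i.
rewrite (_ : (fun t => _) = (fun x : 'rV[R]_n.+1 => x ord0 (lift ord0 i))).
  exact: measurable_coor.
by apply/funext => x; rewrite mxE.
Qed.

Variable mu : {sigma_finite_measure set 'rV[R]_n -> \bar R}.

Definition lebesgue_consrv : set 'rV[R]_n.+1 -> \bar R :=
  pushforward (lebesgue_measure \x mu)%E consrv.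


Let lebesgue_consrv0 : lebesgue_consrv set0 = 0%E.
Proof. by rewrite /lebesgue_consrv /pushforward preimage_set0 measure0. Qed.

Let lebesgue_consrv_ge0 A : (0 <= lebesgue_consrv A)%E.
Proof. by apply: measure_ge0; exact: measurable_consrv. Qed.

Let lebesgue_consrv_sigma_additive : semi_sigma_additive lebesgue_consrv.
Proof.
by apply: measure_semi_sigma_additive; exact: measurable_consrv.
Qed.

HB.instance Definition _ := isMeasure.Build _ _ _ lebesgue_consrv
  lebesgue_consrv0 lebesgue_consrv_ge0 lebesgue_consrv_sigma_additive.

Let lebesgue_consrv_sigma_finite : sigma_finite setT lebesgue_consrv.
Proof.
have /sigma_finiteP[F [TF ndF Foo]] := sigma_finiteT (@lebesgue_measure R).
have /sigma_finiteP[G [TG ndG Goo]] := sigma_finiteT mu.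
exists (fun k => unconsrv @^-1` (F k `*` G k)).
  apply/esym; rewrite -preimage_bigcup -subTset => x _.
  rewrite /preimage /=; case: (unconsrv x) => a b.
  have [k _ Fka] : (\bigcup_k F k) a by rewrite -TF.
  have [l _ Glb] : (\bigcup_l G l) b by rewrite -TG.
  exists (maxn k l) => //; split => /=.
    by move: a Fka; exact/subsetPset/ndF/leq_maxl.
  by move: b Glb; exact/subsetPset/ndG/leq_maxr.
move=> k; have [mF Fk] := Foo k; have [mG Gk] := Goo k.
have mFG : measurable (F k `*` G k) by exact: measurableX.
split.
  by rewrite -[X in measurable X]setTI; exact: measurable_unconsrv.
rewrite /lebesgue_consrv /pushforward -comp_preimage.
rewrite (_ : unconsrv \o consrv = id); last first.
  by apply/funext => p; exact: consrvK.
by rewrite preimage_id product_measure1E// lte_mul_pinfty// ge0_fin_numE.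
Qed.

HB.instance Definition _ := Measure_isSigmaFinite.Build _ _ _ lebesgue_consrv
  lebesgue_consrv_sigma_finite.

End step.

Fixpoint lebesgue_rowv n : {sigma_finite_measure set 'rV[R]_n -> \bar R} :=
  if n is m.+1 then lebesgue_consrv (lebesgue_rowv m) else \d_(0 : 'rV[R]_0).

End lebesgue_rowv.

Section sphere.
Variables (R : realType) (d : nat).
Local Notation V := 'rV[R]_d.+1.
Implicit Types (x : V) (A : set V).

Definition sqnorm x : R := \sum_i x ord0 i ^+ 2.

Definition sphere : set V := [set x | sqnorm x = 1].

Definition cone A : set V :=
  [set t *: x | t in `]0, 1]%classic & x in A `&` sphere].

(* Surface measure as in polar coordinates: (d + 1) times the volume of the
   cone { t x | 0 < t <= 1, x \in A }; the part of A off the sphere is ignored. *)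
Definition surface_measure A : \bar R :=
  ((d.+1)%:R%:E * lebesgue_rowv R d.+1 (cone A))%E.

Definition normalize x : V := (sqnorm x `^ (- 2^-1)) *: x.

Definition pball : set V := [set x | 0 < sqnorm x <= 1].

Lemma sqnormZ t x : sqnorm (t *: x) = t ^+ 2 * sqnorm x.
Proof.
by rewrite /sqnorm mulr_sumr; apply: eq_bigr => i _; rewrite mxE exprMn.
Qed.

Lemma sqnorm_ge0 x : 0 <= sqnorm x.
Proof. by apply: sumr_ge0 => i _; exact: sqr_ge0. Qed.

Lemma coneE A : cone A = (normalize @^-1` A) `&` pball.
Proof.
apply/seteqP; split => [_ [t t01 [x [Ax Sx] <-]]|x [Ax /andP[x0 x1]]].
  move: t01; rewrite /= in_itv /= => /andP[t0 t1].
  have E : sqnorm (t *: x) = t ^+ 2 by rewrite sqnormZ Sx mulr1.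
  split; last by rewrite /pball /= E exprn_gt0 //= expr_le1 // ltW.
  rewrite /preimage /= /normalize E powRN powR12_sqrt ?sqr_ge0 //.
  by rewrite sqrtr_sqr gtr0_norm // scalerA mulVf ?scale1r // gt_eqF.
exists (Num.sqrt (sqnorm x)).
  by rewrite /= in_itv /= sqrtr_gt0 x0 /= -sqrtr1 ler_wsqrtr.
exists (normalize x); last first.
  rewrite /normalize powRN powR12_sqrt ?sqnorm_ge0 // scalerA mulfV ?scale1r //.
  by rewrite gt_eqF // sqrtr_gt0.
split => //; rewrite /sphere /= /normalize sqnormZ powRN powR12_sqrt ?sqnorm_ge0 //.
by rewrite exprVn sqr_sqrtr ?sqnorm_ge0 // mulVf // gt_eqF.
Qed.

Lemma measurable_sqnorm : measurable_fun setT (sqnorm : V -> measurableTypeR R).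
Proof.
apply: measurable_sum => i; apply: measurable_funX; exact: measurable_coor.
Qed.

Lemma measurable_normalize : measurable_fun setT normalize.
Proof.
apply/measurable_fun_rowvP => i; rewrite /normalize.
under eq_fun do rewrite mxE.
apply: measurable_funM; last exact: measurable_coor.
exact: (measurableT_comp (measurable_powR (- 2^-1)) measurable_sqnorm).
Qed.

Lemma measurable_pball : measurable pball.
Proof.
rewrite -[pball]setTI (_ : pball = sqnorm @^-1` `]0, 1]%classic).
  by apply: measurable_sqnorm => //; exact: measurable_itv.
by apply/seteqP; split => x; rewrite /pball /preimage /= in_itv.
Qed.

Lemma measurable_cone A : measurable A -> measurable (cone A).
Proof.
move=> mA; rewrite coneE; apply: measurableI; last exact: measurable_pball.
by rewrite -[X in measurable X]setTI; exact: measurable_normalize.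
Qed.

Let surface_measure0 : surface_measure set0 = 0%E.
Proof. by rewrite /surface_measure coneE preimage_set0 set0I measure0 mule0. Qed.

Let surface_measure_ge0 A : (0 <= surface_measure A)%E.
Proof. by rewrite /surface_measure mule_ge0. Qed.

Let surface_measure_sigma_additive : semi_sigma_additive surface_measure.
Proof.
have HC : forall F : (set V)^nat,
    cone (\bigcup_k F k) = \bigcup_k cone (F k).
  move=> F; rewrite coneE preimage_bigcup setI_bigcupl.
  by apply: eq_bigcupr => k _; rewrite coneE.
have HI A B : A `&` B = set0 -> cone A `&` cone B = set0.
  by move=> AB; rewrite !coneE setIACA -preimage_setI AB preimage_set0 set0I.
move=> F mF tF mUF; rewrite /surface_measure HC.
under eq_fun do rewrite -ge0_sume_distrr //.
apply: cvgeZl => //.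
apply: measure_semi_sigma_additive.
- by move=> k; exact: measurable_cone.
- apply/trivIsetP => /= i j _ _ ij; apply: HI.
  by move/trivIsetP : tF => /(_ _ _ Logic.I Logic.I ij).
- by rewrite -HC; exact: measurable_cone.
Qed.

HB.instance Definition _ := isMeasure.Build _ _ _ surface_measure
  surface_measure0 surface_measure_ge0 surface_measure_sigma_additive.

End sphere.

Arguments sphere {R d}.

Section hyperinterpolation.
Variables (R : realType) (d : nat).
Local Notation V := 'rV[R]_d.+1.
Local Notation surface_measure := (@surface_measure R d).
Implicit Types (x : V) (f g : V -> R).

Definition sphere_int f : R := \int[surface_measure]_(x in sphere) f x.

Definition sphere_area : R := fine (surface_measure sphere).

(* Functions on the sphere are represented by functions on the ambient space of
   which only the restriction to the sphere matters. *)
Definition sphere_L2norm f : \bar R :=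
  'N[surface_measure]_2%:E[EFin \o (f \_ sphere)]%E.

Definition sphere_supnorm f : R := sup [set `|f x| | x in sphere].

Definition sphere_poly n : set (V -> R) :=
  [set g | exists2 p : mpoly.mpoly d.+1 R, (mpoly.msize p <= n.+1)%N &
    forall x, sphere x -> g x = mpoly.meval (x ord0) p].

Definition laplacian (p : mpoly.mpoly d.+1 R) : mpoly.mpoly d.+1 R :=
  \sum_(i < d.+1) mpoly.mderiv i (mpoly.mderiv i p).

Definition spherical_harmonic l : set (V -> R) :=
  [set g | exists p : mpoly.mpoly d.+1 R,
    [/\ p \is mpoly.ishomog1 l mpoly.mdeg, laplacian p = 0 &
        forall x, sphere x -> g x = mpoly.meval (x ord0) p]].

(* Such a family is linearly independent, so z is the dimension of H. *)
Definition sphere_orthonormal_basis (H : set (V -> R)) (z : nat)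
    (Y : 'I_z -> V -> R) : Prop :=
  [/\ forall k, H (Y k),
      forall k k', sphere_int (fun x => Y k x * Y k' x) = (k == k')%:R &
      forall g, H g -> exists c : 'I_z -> R,
        forall x, sphere x -> g x = \sum_k c k * Y k x].

Definition best_approx n f : R :=
  inf [set sphere_supnorm (fun x => f x - g x) | g in sphere_poly n].

Definition discrete_inner m (w : 'I_m -> R) (xs : 'I_m -> V) f g : R :=
  \sum_j w j * f (xs j) * g (xs j).

Definition hyperinterpolant m (w : 'I_m -> R) (xs : 'I_m -> V) (Z : nat -> nat)
    (Y : forall l, 'I_(Z l) -> V -> R) n f : V -> R :=
  fun x => \sum_(l < n.+1) \sum_k discrete_inner w xs f (Y l k) * Y l k x.

End hyperinterpolation.

(* Main.v *)
(** Let g = f - chi with chi in P_n'. Since U_n reproduces P_n' on the sphere,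
    U_n f - f = U_n g - g there, so it suffices to bound the L2 norm of U_n g by
    sqrt (1 + eta) |S|^(1/2) times the supremum of |g|. By orthonormality
    <U_n g, U_n g> = <g, U_n g>_m, and this is controlled by the discrete norms of
    g (the weights sum to |S|) and of U_n g (the Marcinkiewicz-Zygmund inequality).

    Reproduction rests on the two classical facts about spherical harmonics.
    Orthogonality of different degrees: rotations in coordinate planes are products
    of shears, which preserve Lebesgue measure by Fubini and translation
    invariance; differentiating the resulting rotation invariance of the surface
    integral I gives I (x_i d_j p - x_j d_i p) = 0, which yields Green's identity on
    the sphere without any integration over the ball. Decomposition of polynomials:
    the Laplacian of r^(2j+2) h is a positive multiple of r^(2j) h for h harmonic,
    so harmonic components can be split off inductively. *)
Require Import Defs.
From HB Require Import structures.
From mathcomp Require Import all_boot all_order all_algebra.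
From mathcomp Require mpoly.
Import -(notations) mpoly.
From mathcomp Require Import all_classical all_reals all_analysis.
From mathcomp Require Import measurable_realfun ring lra.

Set Implicit Arguments.
Unset Strict Implicit.
Unset Printing Implicit Defensive.

Import Order.TTheory GRing.Theory Num.Theory.
Import numFieldNormedType.Exports.

Local Open Scope classical_set_scope.
Local Open Scope ring_scope.

(** * Homogeneous harmonic polynomials *)

Section harmonic_polynomials.
Variables (R : realType) (d : nat).
Local Notation n := d.+1.
Local Notation P := (mpoly n R).
Local Notation "''x_' i" := (mpolyX R (mnm1 i)) (at level 8, i at level 2).
Local Notation dhomog l p := (p \is ishomog1 l mdeg).
Implicit Types (p q u : P) (i j : 'I_n).

Definition euler p : P := \sum_i 'x_i * mderiv i p.
Definition r2 : P := \sum_i 'x_i ^+ 2.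
(** The infinitesimal generator of rotations in the plane of coordinates i and j, a derivation
    tangent to all spheres centred at the origin. *)
Definition rotation_field i j p : P := 'x_i * mderiv j p - 'x_j * mderiv i p.
Definition harmonic_poly l p := dhomog l p /\ laplacian p = 0.

Lemma mderiv_var i j : mderiv i 'x_j = (i == j)%:R.
Proof.
rewrite mderivX mnm1E eq_sym; case: eqP => [->|_]; last by rewrite scale0r.
by rewrite scale1r -[X in mnm_sub X _](add0m (mnm1 j)) addmK mpolyX0.
Qed.

Lemma euler_linear : linear euler.
Proof.
move=> c p q; rewrite /euler scaler_sumr -big_split; apply: eq_bigr => i _.
by rewrite linearP mulrDr scalerAr.
Qed.
HB.instance Definition _ := GRing.isLinear.Build R P P *:%R euler euler_linear.

Lemma eulerX m : euler (mpolyX R m) = (mdeg m)%:R *: mpolyX R m.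
Proof.
rewrite /euler mdegE natr_sum scaler_suml; apply: eq_bigr => i _.
rewrite mderivX -scalerAr -mpolyXD.
have [->|mi] := eqVneq (m i) 0%N; first by rewrite !scale0r.
by rewrite addmC submK // lep1mP.
Qed.

Lemma euler_dhomog l p : dhomog l p -> euler p = l%:R *: p.
Proof.
move=> /dhomogP hp; rewrite [in LHS](mpolyE p) [in RHS](mpolyE p).
rewrite linear_sum scaler_sumr.
rewrite big_seq [RHS]big_seq; apply: eq_bigr => m /hp <-.
by rewrite linearZ /= eulerX !scalerA mulrC.
Qed.

Lemma eulerM p q : euler (p * q) = euler p * q + p * euler q.
Proof.
rewrite /euler mulr_suml mulr_sumr -big_split; apply: eq_bigr => i _ /=.
by rewrite mderivM; ring.
Qed.

Lemma euler_var i : euler 'x_i = 'x_i.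
Proof. by rewrite eulerX mdeg1 scale1r. Qed.

Lemma dhomog_mderiv l p i : dhomog l.+1 p -> dhomog l (mderiv i p).
Proof.
move=> /dhomogP hp; apply/dhomogP => m; rewrite mcoeff_msupp mcoeff_mderiv.
move=> nz; have /hp : mnm_add m (mnm1 i) \in msupp p.
  by rewrite mcoeff_msupp; apply: contraNneq nz => ->; rewrite mul0rn.
by rewrite /= mdegD mdeg1 addn1 => -[].
Qed.

Lemma dhomog0_mderiv p i : dhomog 0 p -> mderiv i p = 0.
Proof.
move=> /dhomogP hp; apply/mpolyP => m; rewrite mcoeff_mderiv mcoeff0.
rewrite memN_msupp_eq0 ?mul0rn //; apply/negP => /hp.
by rewrite /= mdegD mdeg1 addn1.
Qed.

Lemma laplacian_linear : linear (@laplacian R d).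
Proof.
move=> c p q; rewrite /laplacian scaler_sumr -big_split; apply: eq_bigr => i _.
by rewrite !linearP.
Qed.
HB.instance Definition _ :=
  GRing.isLinear.Build R P P *:%R (@laplacian R d) laplacian_linear.

Lemma dhomog_laplacian l p : dhomog l.+2 p -> dhomog l (laplacian p).
Proof. by move=> hp; apply: rpred_sum => i _; do 2!apply: dhomog_mderiv. Qed.

Lemma laplacian_dhomog1 l p : (l < 2)%N -> dhomog l p -> laplacian p = 0.
Proof.
case: l => [|[|//]] _ hp; rewrite /laplacian big1 // => i _.
  by rewrite (dhomog0_mderiv i hp) mderiv0.
exact: dhomog0_mderiv (dhomog_mderiv i hp).
Qed.

Lemma dhomog_r2 : dhomog 2 r2.
Proof.
apply: rpred_sum => i _; apply: (@dhomogMn _ _ _ 1).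
by rewrite dhomogX /= mdeg1.
Qed.

Lemma mderiv_r2 i : mderiv i r2 = 2%:R * 'x_i.
Proof.
rewrite /r2 raddf_sum (bigD1 i) //= big1 => [|j ji]; last first.
  by rewrite expr2 mderivM mderiv_var eq_sym (negbTE ji) mulr0n mul0r mulr0 addr0.
by rewrite expr2 mderivM mderiv_var eqxx mulr1n; ring.
Qed.

(** The product rule leaves the cross term [4 * euler u], which Euler's identity turns into a
    multiple of u. *)
Lemma laplacian_r2M u a : dhomog a u ->
  laplacian (r2 * u) = (2 * n + 4 * a)%N%:R *: u + r2 * laplacian u.
Proof.
move=> hu; have := euler_dhomog hu; rewrite /euler /laplacian => hE.
transitivity (\sum_(i < n) (2%:R * u + 4%:R * ('x_i * mderiv i u)
              + r2 * mderiv i (mderiv i u))).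
  apply: eq_bigr => i _; rewrite !(mderivM, mderivD) mderiv_r2.
  have -> : mderiv i (2%:R * 'x_i) = 2%:R.
    rewrite mderivM mderiv_var eqxx mulr1n -(mpolyC_nat n R 2) mderivC; ring.
  ring.
rewrite !big_split /= sumr_const card_ord -!mulr_sumr hE.
by congr (_ + _); rewrite !scaler_nat; ring.
Qed.

(* The constant is 2(j+1)(2j+2+2k+n-2), but only its sign matters. *)
Lemma laplacian_r2Xn k h (j : nat) : harmonic_poly k h ->
  exists2 c : nat, (0 < c)%N & laplacian (r2 ^+ j.+1 * h) = c%:R *: (r2 ^+ j * h).
Proof.
move=> [hh lh]; elim: j => [|j [c c0 IH]].
  exists (2 * n + 4 * k)%N => //.
  by rewrite expr1 (laplacian_r2M hh) lh mulr0 addr0 expr0 mul1r.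
exists (2 * n + 4 * (2 * j.+1 + k) + c)%N; first by rewrite addn_gt0 c0 orbT.
have hj : dhomog (2 * j.+1 + k) (r2 ^+ j.+1 * h).
  by apply: dhomogM => //; apply: dhomogMn; exact: dhomog_r2.
rewrite exprS -mulrA (laplacian_r2M hj) IH [in RHS]natrD [RHS]scalerDl.
by congr (_ + _); rewrite -scalerAr mulrA -exprS.
Qed.

Lemma dhomog_r2Xn k h (j : nat) : dhomog k h -> dhomog (2 * j + k) (r2 ^+ j * h).
Proof.
by move=> hh; apply: dhomogM => //; apply: dhomogMn; exact: dhomog_r2.
Qed.

(* Given p, the induction hypothesis for laplacian p provides q in the span of
   the r2 ^+ j * h with laplacian q = laplacian p, so that p - q is harmonic. *)
Lemma harmonic_decomposition_ind l (Q : P -> Prop) :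
  Q 0 -> (forall p q, Q p -> Q q -> Q (p + q)) ->
  (forall (j : nat) k h, (2 * j + k)%N = l -> harmonic_poly k h ->
    Q (r2 ^+ j * h)) ->
  forall p, dhomog l p -> Q p.
Proof.
elim/ltn_ind: l Q => -[_|[_|l IHl]] Q Q0 QD Qr p hp.
- rewrite -[p]mul1r -(expr0 r2); apply: (Qr _ 0%N) => //; split => //.
  exact: (@laplacian_dhomog1 0).
- rewrite -[p]mul1r -(expr0 r2); apply: (Qr _ 1%N) => //; split => //.
  exact: (@laplacian_dhomog1 1).
(* The induction is run on the property of having a homogeneous preimage under the Laplacian that
   satisfies [Q]. *)
pose Q' u := exists q, [/\ dhomog l.+2 q, Q q & laplacian q = u].
have [//|||||q [hq Qq lq]] := IHl l _ Q' _ _ _ (laplacian p).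
- by exists 0; rewrite rpred0 linear0.
- move=> _ _ [q1 [h1 Q1 <-]] [q2 [h2 Q2 <-]]; exists (q1 + q2).
  by rewrite rpredD // linearD; split => //; exact: QD.
- move=> j k h jk hh; have [c c0 lc] := laplacian_r2Xn j hh.
  (* The inverse scalar is absorbed into the harmonic factor, since [Q] is not assumed stable under
     scaling. *)
  have E : r2 ^+ j.+1 * (c%:R^-1 *: h) = c%:R^-1 *: (r2 ^+ j.+1 * h).
    by rewrite scalerAr.
  have jk2 : (2 * j.+1 + k)%N = l.+2 by rewrite mulnS -addnA jk.
  have hc : harmonic_poly k (c%:R^-1 *: h).
    by case: hh => hh lh; split; [exact: rpredZ|rewrite linearZ /= lh scaler0].
  exists (r2 ^+ j.+1 * (c%:R^-1 *: h)); split.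
  + by rewrite -jk2; apply: dhomog_r2Xn; case: hc.
  + exact: Qr jk2 hc.
  + by rewrite E linearZ /= lc scalerA mulVf ?scale1r // pnatr_eq0 -lt0n.
- exact: dhomog_laplacian.
rewrite -(subrK q p); apply: QD => //.
rewrite -[p - q]mul1r -(expr0 r2); apply: (Qr _ l.+2) => //; split.
  exact: rpredB.
by rewrite linearB /= lq subrr.
Qed.

(* Green's identity for the field q grad p, in terms of the tangential
   fields rotation_field i j, which are divergence free on the sphere. *)
Lemma green_rotation_field k l p q : dhomog k q -> harmonic_poly l p ->
  \sum_i \sum_j rotation_field i j ('x_i * (q * mderiv j p)) =
  r2 * (\sum_j mderiv j q * mderiv j p)
  + ((2 - (n + k + l)%:R) * l%:R) *: (q * p).
Proof.
move=> hq [hp lp].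
pose u j := q * mderiv j p; pose xu := \sum_j 'x_j * u j.
have xuE : xu = l%:R *: (q * p).
  rewrite /xu scalerAr -(euler_dhomog hp) mulr_sumr; apply: eq_bigr => j _.
  by rewrite /u; ring.
(* [euler] is a derivation fixing the variables, so this sum is [euler xu - xu], and [xu] is
   homogeneous of degree k + l. *)
have Exu : \sum_j 'x_j * euler (u j) = ((k + l)%:R - 1) *: xu.
  rewrite scalerBl scale1r; apply/eqP; rewrite eq_sym subr_eq; apply/eqP.
  have <- : euler xu = (k + l)%:R *: xu.
    by apply: euler_dhomog; rewrite xuE rpredZ // dhomogM.
  rewrite linear_sum -big_split; apply: eq_bigr => j _ /=.
  by rewrite eulerM euler_var addrC.
have divu : \sum_j mderiv j (u j) = \sum_j mderiv j q * mderiv j p.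
  have qlp : \sum_j q * mderiv j (mderiv j p) = 0.
    by rewrite -mulr_sumr -/(laplacian p) lp mulr0.
  rewrite -[RHS]addr0 -[X in _ + X]qlp -big_split.
  by apply: eq_bigr => j _; rewrite mderivM.
(* These four terms are what the product rule yields on the two halves of [rotation_field], summed
   over i and j. Below, each becomes a double sum, so that the identity can be checked for each pair
   of indices. *)
transitivity (xu + r2 * (\sum_j mderiv j (u j)) - n%:R *: xu
              - \sum_j 'x_j * euler (u j)); last first.
  rewrite -scalerA -xuE Exu divu [xu + _]addrC -[LHS]addrA -[LHS]addrA.
  congr (_ + _); rewrite -[X in X + _ = _]scale1r -scaleNr -scalerBl -scalerDl.
  by congr (_ *: _); rewrite !natrD; ring.
have -> : n%:R *: xu = \sum_(i < n) xu.
  by rewrite sumr_const card_ord scaler_nat.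
have -> : xu = \sum_i \sum_j (i == j)%:R * ('x_i * u j).
  apply: eq_bigr => i _; rewrite (bigD1 i) //= eqxx mul1r big1 ?addr0 // => j.
  by rewrite eq_sym => /negbTE->; rewrite mul0r.
have -> : r2 * (\sum_j mderiv j (u j)) =
    \sum_i \sum_j 'x_i ^+ 2 * mderiv j (u j).
  by rewrite mulr_suml; apply: eq_bigr => i _; rewrite mulr_sumr.
have -> : \sum_j 'x_j * euler (u j) =
    \sum_i \sum_j 'x_j * ('x_i * mderiv i (u j)).
  by rewrite exchange_big; apply: eq_bigr => j _; rewrite mulr_sumr.
(* The expansion of [xu] also reached its n copies; these are restored to single sums. *)
have -> : \sum_(i < n) (\sum_i \sum_j (i == j)%:R * ('x_i * u j)) =
   \sum_(i < n) \sum_j 'x_j * u j.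
  apply: eq_bigr => _ _.
  apply: eq_bigr => i _; rewrite (bigD1 i) //= eqxx mul1r big1 ?addr0 // => j.
  by rewrite eq_sym => /negbTE->; rewrite mul0r.
rewrite -!sumrN -!big_split; apply: eq_bigr => i _ /=.
rewrite -!sumrN -!big_split; apply: eq_bigr => j _ /=.
rewrite /rotation_field -/(u j) !mderivM !mderiv_var eqxx mulr1n [j == i]eq_sym.
ring.
Qed.

(** Applying I to Green's identity gives the integral of [r2] times the product of gradients as (n +
    k + l - 2) l I(q p). The left side is symmetric in p and q, so (n + k + l - 2) (l - k) I(q p) =
    0. *)
Lemma harmonic_orthogonal (I : {linear P -> R | *%R}) k l p q :
  (forall i j u, I (rotation_field i j u) = 0) -> (2 <= n)%N ->
  harmonic_poly k q -> harmonic_poly l p -> k != l -> I (q * p) = 0.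
Proof.
move=> Irot n2 hq hp kl.
have G a b u v : harmonic_poly a u -> harmonic_poly b v ->
    I (r2 * (\sum_j mderiv j u * mderiv j v)) =
    ((n + a + b)%:R - 2) * b%:R * I (u * v).
  move=> hu hv; have [hu' _] := hu.
  have := congr1 I (green_rotation_field hu' hv).
  rewrite linear_sum big1 => [|i _]; last by rewrite linear_sum big1.
  rewrite linearD linearZ =>  /esym/eqP; rewrite addr_eq0 => /eqP ->.
  by rewrite -!mulNr opprB.
have := G _ _ _ _ hq hp; have := G _ _ _ _ hp hq.
rewrite (eq_bigr (fun j => mderiv j q * mderiv j p)) => [->|j _]; last first.
  by rewrite mulrC.
rewrite [p * q]mulrC (addnAC _ l k) => /eqP; rewrite -subr_eq0 -mulrBl -mulrBr.
rewrite !mulf_eq0 subr_eq0 eqr_nat subr_eq0 eqr_nat (negbTE kl) orbF.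
(* Since n is at least 2 and k, l are distinct, n + k + l exceeds 2. *)
case/orP=> [/eqP H|/eqP //]; exfalso; move: n2 kl H.
case: k {hq} => [|k]; case: l {hp} => [|l] //; case: d => // d' _ _;
  rewrite ?addnS ?addSn //.
Qed.

End harmonic_polynomials.

(** * Shear invariance of Lebesgue measure *)

Lemma measurable_preimageT d1 d2 (T1 : measurableType d1) (T2 : measurableType d2)
    (f : T1 -> T2) (A : set T2) :
  measurable_fun setT f -> measurable A -> measurable (f @^-1` A).
Proof. by move=> mf mA; rewrite -[X in measurable X]setTI; exact: mf. Qed.

(** Tonelli for sets: volumes may be computed by slicing along either factor. *)
Lemma product_measure12 d1 d2 (T1 : measurableType d1) (T2 : measurableType d2)
    (R : realType) (m1 : {sigma_finite_measure set T1 -> \bar R})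
    (m2 : {sigma_finite_measure set T2 -> \bar R}) (A : set (T1 * T2)) :
  measurable A -> (m1 \x m2)%E A = (m1 \x^ m2)%E A.
Proof.
move=> mA; apply: product_measure_unique => //= B C mB mC.
by rewrite product_measure2E.
Qed.

Section rowv_lebesgue.
Variable R : realType.

Lemma lebesgue_measure_translate (a : R) (A : set (measurableTypeR R)) :
  measurable A ->
  lebesgue_measure ((fun x : measurableTypeR R => x + a : measurableTypeR R) @^-1` A)
  = lebesgue_measure A.
Proof.
move=> mA; apply/esym.
have mT : measurable_fun setT (fun x : measurableTypeR R => x + a : measurableTypeR R).
  exact: measurable_funD.
apply: (lebesgue_measure_unique (mu := pushforward lebesgue_measure
  (fun x : measurableTypeR R => x + a : measurableTypeR R))) => // _ [[b c]] _ <-.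
transitivity (lebesgue_measure (`]b - a, c - a]%classic : set (measurableTypeR R))).
  by rewrite !lebesgue_measure_itv /= !lte_fin ltrD2r -!EFinB opprB addrA subrK.
congr lebesgue_measure.
by apply/seteqP; split => x; rewrite /preimage /= !in_itv /= ltrBlDr lerBrDr.
Qed.


Lemma consrv0 n a (y : 'rV[R]_n) : consrv (a, y) ord0 ord0 = a.
Proof. by have [] := congr1 (fun p => p) (consrvK (a, y)). Qed.

Lemma consrv_lift n a (y : 'rV[R]_n) j :
  consrv (a, y) ord0 (lift ord0 j) = y ord0 j.
Proof. by have [_ /rowP/(_ j)] := consrvK (a, y); rewrite mxE. Qed.

Lemma addZdeltaE n (x : 'rV[R]_n) c i k :
  (x + c *: delta_mx ord0 i) ord0 k = x ord0 k + c * (k == i)%:R.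
Proof. by rewrite !mxE. Qed.

Lemma consrvDr n a (y : 'rV[R]_n) c j :
  consrv (a, y) + c *: delta_mx ord0 (lift ord0 j)
  = consrv (a, y + c *: delta_mx ord0 j).
Proof.
apply/rowP => k; rewrite addZdeltaE; case: (unliftP ord0 k) => [l|] ->.
  by rewrite !consrv_lift addZdeltaE (inj_eq lift_inj).
by rewrite !consrv0 mulr0 addr0.
Qed.

Lemma consrvDl n a (y : 'rV[R]_n) c :
  consrv (a, y) + c *: delta_mx ord0 ord0 = consrv (a + c, y).
Proof.
apply/rowP => k; rewrite addZdeltaE; case: (unliftP ord0 k) => [l|] ->.
  by rewrite !consrv_lift mulr0 addr0.
by rewrite !consrv0 mulr1.
Qed.

Lemma measurable_shear n (i : 'I_n) (h : 'rV[R]_n -> R) :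
  measurable_fun setT (h : 'rV[R]_n -> measurableTypeR R) ->
  measurable_fun setT (fun x : 'rV[R]_n => x + h x *: delta_mx ord0 i).
Proof.
move=> mh; apply/measurable_fun_rowvP => k.
under eq_fun do rewrite addZdeltaE.
apply: measurable_funD; first exact: measurable_coor.
by apply: measurable_funM.
Qed.

(** Induction on the dimension. If the sheared coordinate is not the first, each slice at a fixed
    first coordinate undergoes a shear of the same kind; if it is the first, each line parallel to
    the first axis is translated. *)
Lemma lebesgue_rowv_shear n (i : 'I_n) (h : 'rV[R]_n -> R) (A : set 'rV[R]_n) :
  measurable_fun setT (h : 'rV[R]_n -> measurableTypeR R) ->
  (forall x c, h (x + c *: delta_mx ord0 i) = h x) -> measurable A ->
  lebesgue_rowv R n ((fun x => x + h x *: delta_mx ord0 i) @^-1` A)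
  = lebesgue_rowv R n A.
Proof.
elim: n i h A => [[]//|n IHn] i h A mh hi mA.
have mhA : measurable ((fun x => x + h x *: delta_mx ord0 i) @^-1` A).
  exact: measurable_preimageT (measurable_shear i mh) mA.
have mc (B : set 'rV[R]_n.+1) : measurable B -> measurable (@consrv R n @^-1` B).
  exact: measurable_preimageT (@measurable_consrv R n).
have mhc (a : R) : measurable_fun setT (fun y : 'rV[R]_n => h (consrv (a, y))
    : measurableTypeR R).
  apply: (measurableT_comp mh); apply: (measurableT_comp (@measurable_consrv R n)).
  exact: measurable_pair1.
rewrite /= /lebesgue_consrv /pushforward.
case: (unliftP ord0 i) hi mhA => [j|] ->{i} hi mhA.
  rewrite /product_measure1; apply: eq_integral => a _ /=.
  pose hy (y : 'rV[R]_n) := h (consrv (a, y)).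
  have hyi y c : hy (y + c *: delta_mx ord0 j) = hy y by rewrite /hy -consrvDr hi.
  rewrite -[RHS](IHn j hy _ (mhc a) hyi); last first.
    by apply: measurable_xsection; exact: mc.
  congr (lebesgue_rowv R n _); apply/seteqP; split => y;
    by rewrite /xsection /preimage /= !inE /= consrvDr.
rewrite !product_measure12; [|exact: mc..].
rewrite /product_measure2; apply: eq_integral => y _ /=.
(* By [hi], [h] is constant along the line over [y], so the translation length can be read off at
   first coordinate 0. *)
rewrite -[RHS](@lebesgue_measure_translate (h (consrv (0, y)))); last first.
  by apply: measurable_ysection; exact: mc.
congr lebesgue_measure; apply/seteqP; split => x;
  rewrite /ysection /preimage /= !inE /=;
  by rewrite consrvDl -(hi (consrv (0, y)) x) consrvDl add0r.
Qed.

(** A set of finite volume containing the cone over the sphere, whence the sphere has finite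
    area. *)
Definition cube n : set 'rV[R]_n := [set x | forall i, `|x ord0 i| <= 1].

Lemma measurable_cube n : measurable (@cube n).
Proof.
rewrite (_ : @cube n = \bigcap_(i in [set: 'I_n])
    ((fun x : 'rV[R]_n => x ord0 i) @^-1` [set` `[-1, 1]%R])).
  apply: fin_bigcap_measurable => [|i _]; first exact: finite_finset.
  apply: measurable_preimageT (measurable_coor i) _.
  exact: measurable_itv.
apply/seteqP; split => x; rewrite /cube /preimage /bigcap /=.
  by move=> h i _; rewrite in_itv /= -ler_norml.
by move=> h i; have := h i Logic.I; rewrite in_itv /= -ler_norml.
Qed.

Lemma lebesgue_rowv_cube n : (lebesgue_rowv R n (@cube n) < +oo)%E.
Proof.
elim: n => [|n IHn].
  by rewrite /= diracE ltry.
rewrite /= /lebesgue_consrv /pushforward.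
rewrite (_ : _ @^-1` _ = [set` `[-1, 1]%R] `*` @cube n); last first.
  apply/seteqP; split => [[a y]|[a y] [a1 y1] i].
    move=> h; split; first by have := h ord0; rewrite consrv0 /= in_itv -ler_norml.
    by move=> i; have := h (lift ord0 i); rewrite consrv_lift.
  case: (unliftP ord0 i) => [j|] ->; first by rewrite consrv_lift; exact: y1.
  by rewrite consrv0; move: a1; rewrite /= in_itv /= -ler_norml.
rewrite product_measure1E; [|exact: measurable_itv|exact: measurable_cube].
have I1 : (lebesgue_measure ([set` `[(-1)%R, 1%R]] : set (measurableTypeR R)) < +oo)%E.
  by rewrite lebesgue_measure_itv /=; case: ifP => // _; exact: ltry.
by rewrite lte_mul_pinfty // ge0_fin_numE.
Qed.

End rowv_lebesgue.

(** * Rotation invariance of the surface measure *)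

Lemma sum_two_terms (R : nmodType) (I : finType) (i j : I) (F : I -> R) : i != j ->
  \sum_k F k = F i + F j + \sum_(k | (k != i) && (k != j)) F k.
Proof.
move=> ij; rewrite (bigD1 i) //= (bigD1 j) /=; last by rewrite eq_sym.
by rewrite addrA.
Qed.

Section rotation.
Variables (R : realType) (d : nat).
Local Notation V := 'rV[R]_d.+1.
Implicit Types (x : V) (i j : 'I_d.+1) (t a : R) (A : set V).

Definition shear i j a x : V := x + (a * x ord0 j) *: delta_mx ord0 i.

Lemma measurable_shear1 i j a : measurable_fun setT (shear i j a).
Proof.
apply: (@measurable_shear R _ i (fun x => a * x ord0 j)).
by apply: measurable_funM => //; exact: measurable_coor.
Qed.

Lemma lebesgue_rowv_shear1 i j a A : i != j -> measurable A ->
  lebesgue_rowv R d.+1 (shear i j a @^-1` A) = lebesgue_rowv R d.+1 A.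
Proof.
move=> ij; apply: (@lebesgue_rowv_shear R _ i (fun x => a * x ord0 j)).
  by apply: measurable_funM => //; exact: measurable_coor.
by move=> x c; rewrite addZdeltaE eq_sym (negbTE ij) mulr0 addr0.
Qed.

(* The rotation in the plane of coordinates i and j whose half-angle has
   tangent t, factored into three shears. *)
Definition rotate i j t x : V :=
  shear i j (- t) (shear j i (2 * t / (1 + t ^+ 2)) (shear i j (- t) x)).

Lemma sqrD1_neq0 t : 1 + t ^+ 2 != 0.
Proof. by rewrite lt0r_neq0 // ltr_pwDl // sqr_ge0. Qed.

Lemma rotate_fst i j t x : i != j -> rotate i j t x ord0 i =
  (1 - t ^+ 2) / (1 + t ^+ 2) * x ord0 i - 2 * t / (1 + t ^+ 2) * x ord0 j.
Proof.
move=> ij; have ji : (j == i) = false by rewrite eq_sym; exact: negbTE.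
rewrite !addZdeltaE !eqxx ji (negbTE ij) !mulr1n !mulr0n; by field; exact: sqrD1_neq0.
Qed.

Lemma rotate_snd i j t x : i != j -> rotate i j t x ord0 j =
  2 * t / (1 + t ^+ 2) * x ord0 i + (1 - t ^+ 2) / (1 + t ^+ 2) * x ord0 j.
Proof.
move=> ij; have ji : (j == i) = false by rewrite eq_sym; exact: negbTE.
rewrite !addZdeltaE !eqxx ji !mulr1n !mulr0n; by field; exact: sqrD1_neq0.
Qed.

Lemma rotate_other i j t x k : k != i -> k != j ->
  rotate i j t x ord0 k = x ord0 k.
Proof.
by move=> ki kj; rewrite !addZdeltaE (negbTE ki) (negbTE kj) !mulr0 !addr0.
Qed.

Lemma sqnorm_rotate i j t x : i != j -> sqnorm (rotate i j t x) = sqnorm x.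
Proof.
move=> ij; rewrite /sqnorm !(sum_two_terms _ ij); congr (_ + _).
  rewrite rotate_fst // rotate_snd //; by field; exact: sqrD1_neq0.
by apply: eq_bigr => k /andP[ki kj]; rewrite rotate_other.
Qed.

Lemma sphere_rotate i j t x : i != j -> sphere (rotate i j t x) = sphere x.
Proof. by move=> ij; rewrite /sphere /= sqnorm_rotate. Qed.

Lemma rotateZ i j t c x : rotate i j t (c *: x) = c *: rotate i j t x.
Proof.
have sZ k l a y : shear k l a (c *: y) = c *: shear k l a y.
  by rewrite /shear scalerDr scalerA mxE; congr (_ + _ *: _); rewrite mulrCA.
by rewrite /rotate !sZ.
Qed.

Lemma measurable_rotate i j t : measurable_fun setT (rotate i j t).
Proof.
apply: (measurableT_comp (measurable_shear1 _ _ _)).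
by apply: (measurableT_comp (measurable_shear1 _ _ _)); exact: measurable_shear1.
Qed.

Lemma lebesgue_rowv_rotate i j t A : i != j -> measurable A ->
  lebesgue_rowv R d.+1 (rotate i j t @^-1` A) = lebesgue_rowv R d.+1 A.
Proof.
move=> ij mA; have ji : j != i by rewrite eq_sym.
have m1 := measurable_preimageT (measurable_shear1 i j (- t)) mA.
have m2 := measurable_preimageT
  (measurable_shear1 j i (2 * t / (1 + t ^+ 2))) m1.
rewrite -[RHS](lebesgue_rowv_shear1 (- t) ij mA).
rewrite -[RHS](lebesgue_rowv_shear1 (2 * t / (1 + t ^+ 2)) ji m1).
by rewrite -[RHS](lebesgue_rowv_shear1 (- t) ij m2).
Qed.

(** Rotations commute with scaling and preserve [sqnorm], hence commute with [normalize] and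
    preserve [pball]. *)
Lemma cone_rotate i j t A : i != j ->
  cone (rotate i j t @^-1` A) = rotate i j t @^-1` cone A.
Proof.
move=> ij; rewrite !coneE; apply/seteqP; split => x;
  by rewrite /pball /normalize /preimage /= !sqnorm_rotate // rotateZ.
Qed.

Lemma surface_measure_rotate i j t A : i != j -> measurable A ->
  surface_measure (rotate i j t @^-1` A) = surface_measure A.
Proof.
move=> ij mA; rewrite /surface_measure cone_rotate // lebesgue_rowv_rotate //.
exact: measurable_cone.
Qed.

End rotation.

(** * Integration of bounded functions over the sphere *)

Section sphere_integral.
Variables (R : realType) (d : nat).
Local Notation V := 'rV[R]_d.+1.
Local Notation omega := (@surface_measure R d).
Implicit Types (x : V) (f g : V -> R) (B : R).

Lemma measurable_sphere : measurable (@sphere R d).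
Proof.
rewrite (_ : sphere = @sqnorm R d @^-1` [set 1]) //.
apply: measurable_preimageT; first exact: measurable_sqnorm.
exact: measurable_set1.
Qed.
Hint Resolve measurable_sphere : core.

Lemma norm_coord_sphere x i : sphere x -> `|x ord0 i| <= 1.
Proof.
rewrite /sphere /= /sqnorm (bigD1 i) //= => x1.
rewrite -(ler_pXn2r (n := 2)) ?nnegrE // expr1n real_normK ?num_real //.
by rewrite -x1 lerDl sumr_ge0 // => k _; rewrite sqr_ge0.
Qed.

Lemma surface_measure_sphere_lty : (omega sphere < +oo)%E.
Proof.
rewrite /= /surface_measure; apply: lte_mul_pinfty => //.
have cube_cone : cone sphere `<=` @cube R d.+1.
  move=> _ [t t01 [x [_ Sx] <-]] i; rewrite mxE normrM.
  move: t01; rewrite /= in_itv /= => /andP[t0 t1].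
  by rewrite mulr_ile1 // ?norm_coord_sphere // ger0_norm // ltW.
apply: le_lt_trans (lebesgue_rowv_cube R d.+1).
apply: le_measure => //; rewrite inE; [exact: measurable_cone|exact: measurable_cube].
Qed.

Lemma sphere_area_ge0 : 0 <= sphere_area R d.
Proof. exact: fine_ge0. Qed.

Lemma sphere_integrable f B :
  measurable_fun sphere f -> (forall x, sphere x -> `|f x| <= B) ->
  omega.-integrable sphere (EFin \o f).
Proof.
move=> mf fB; apply: measurable_bounded_integrable => //.
  exact: surface_measure_sphere_lty.
by exists B; split => [|M BM x /fB fxB]; [exact: num_real|exact: le_trans fxB (ltW BM)].
Qed.

Lemma norm_sphere_int_le f B :
  measurable_fun sphere f -> (forall x, sphere x -> `|f x| <= B) ->
  `|sphere_int f| <= B * sphere_area R d.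
Proof.
move=> mf fB; have If := sphere_integrable mf fB.
apply: le_trans (le_normr_Rintegral measurable_sphere If) _.
rewrite /sphere_area -Rintegral_cst //; apply: le_Rintegral => //.
- apply: (@sphere_integrable _ B); first exact: measurableT_comp.
  by move=> x Sx; rewrite normr_id fB.
- by apply: (@sphere_integrable _ `|B|).
Qed.

(** Change of variables: the surface measure is its own pushforward under a rotation. *)
Lemma sphere_int_rotate f B i j t : i != j ->
  measurable_fun setT f -> (forall x, sphere x -> `|f x| <= B) ->
  sphere_int (fun x => f (rotate i j t x)) = sphere_int f.
Proof.
move=> ij mf fB.
have rS : rotate i j t @^-1` sphere = @sphere R d.
  by apply/seteqP; split => x; rewrite /preimage /= sphere_rotate.
have mr := measurable_rotate i j t.
rewrite /sphere_int /Rintegral; congr fine.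
transitivity (\int[pushforward omega (rotate i j t)]_(x in sphere) (f x)%:E)%E.
  rewrite integral_pushforward ?rS //; first exact/measurable_EFinP.
  apply: (@sphere_integrable _ B).
    by apply: measurable_funTS; exact: (measurableT_comp mf mr).
  by move=> x Sx; apply: fB; rewrite sphere_rotate.
apply: eq_measure_integral => A mA _.
exact: surface_measure_rotate.
Qed.

End sphere_integral.

(** * Surface integrals of polynomials *)

Section polynomials_on_sphere.
Variables (R : realType) (d : nat).
Local Notation V := 'rV[R]_d.+1.
Local Notation P := (mpoly d.+1 R).
Local Notation "''x_' i" := (mpolyX R (mnm1 i)) (at level 8, i at level 2).
Local Notation ev p x := (meval (x ord0) p).
Implicit Types (p q : P) (x : V) (i j : 'I_d.+1).

(** Induction along the ring operations, fitted to properties such as boundedness or Taylor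
    expansion that pass to sums and products. *)
Lemma mpoly_ring_ind (K : P -> Prop) :
  (forall c, K (mpolyC d.+1 c)) -> (forall i, K 'x_i) ->
  (forall p q, K p -> K q -> K (p + q)) ->
  (forall p q, K p -> K q -> K (p * q)) -> forall p, K p.
Proof.
move=> KC KX KD KM p; rewrite (mpolyE p); apply: big_ind => // [|m _].
  by rewrite -(mpolyC0 d.+1 R); exact: KC.
rewrite -mul_mpolyC; apply: (KM) => //; rewrite mpolyXE_id.
apply: big_ind => // [|i _]; first by rewrite -(mpolyC1 d.+1 R); exact: KC.
elim: (m i) => [|k IH]; first by rewrite expr0 -(mpolyC1 d.+1 R); exact: KC.
by rewrite exprS; exact: KM.
Qed.

Lemma measurable_meval p : measurable_fun setT (fun x : V => ev p x).
Proof.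
elim/mpoly_ring_ind: p => [c|i|p q mp mq|p q mp mq].
- by under eq_fun do rewrite mevalC; exact: measurable_cst.
- by under eq_fun do rewrite mevalXU; exact: measurable_coor.
- by under eq_fun do rewrite mevalD; exact: measurable_funD.
- by under eq_fun do rewrite mevalM; exact: measurable_funM.
Qed.

Lemma meval_sphere_bounded p :
  exists2 B : R, 0 <= B & forall x, sphere x -> `|ev p x| <= B.
Proof.
elim/mpoly_ring_ind: p => [c|i|p q [B B0 pB] [C C0 qC]|p q [B B0 pB] [C C0 qC]].
- by exists `|c| => // x _; rewrite mevalC.
- by exists 1 => // x Sx; rewrite mevalXU norm_coord_sphere.
- exists (B + C); first exact: addr_ge0.
  by move=> x Sx; rewrite mevalD (le_trans (ler_normD _ _)) // lerD ?pB ?qC.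
- exists (B * C); first exact: mulr_ge0.
  by move=> x Sx; rewrite mevalM normrM ler_pM ?pB ?qC.
Qed.

Lemma meval_integrable p :
  (@surface_measure R d).-integrable sphere (EFin \o (fun x => ev p x)).
Proof.
have [B _ pB] := meval_sphere_bounded p.
by apply: (sphere_integrable _ pB); apply: measurable_funTS; exact: measurable_meval.
Qed.

Definition poly_int p : R := sphere_int (fun x : V => ev p x).

Lemma poly_int_linear : linear_for *%R poly_int.
Proof.
move=> c p q; rewrite /poly_int /sphere_int.
under eq_Rintegral do rewrite mevalD mevalZ.
rewrite RintegralD ?RintegralZl //; try exact: measurable_sphere;
  try exact: meval_integrable.
have := meval_integrable (c *: p); apply: eq_integrable => //.
  exact: measurable_sphere.
by move=> x _; rewrite /= mevalZ.
Qed.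
HB.instance Definition _ :=
  GRing.isLinear.Build R P R *%R poly_int poly_int_linear.

(** With t the tangent of the half-angle, 2t / (1 + t^2) is the sine of the rotation angle and (1 -
    t^2) / (1 + t^2) its cosine. This bound and the next compare them with their first-order parts
    2t and 1. *)
Let norm_sin_sub (t : R) : `|t| <= 1 ->
  `|2 * t - 2 * t / (1 + t ^+ 2)| <= 2 * t ^+ 2.
Proof.
move=> t1.
have -> : 2 * t - 2 * t / (1 + t ^+ 2) = 2 * t ^+ 2 * (t / (1 + t ^+ 2)).
  by field; exact: sqrD1_neq0.
have t2 : 0 <= 2 * t ^+ 2 by rewrite mulr_ge0 // sqr_ge0.
rewrite normrM (ger0_norm t2) ler_piMr //.
rewrite normrM normfV ler_pdivrMr ?normr_gt0 ?sqrD1_neq0 // mul1r.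
by rewrite (le_trans t1) // ger0_norm ?addr_ge0 ?sqr_ge0 // lerDl sqr_ge0.
Qed.

Let norm_1_sub_cos (t : R) : `|(1 - t ^+ 2) / (1 + t ^+ 2) - 1| <= 2 * t ^+ 2.
Proof.
have -> : (1 - t ^+ 2) / (1 + t ^+ 2) - 1 = - (2 * t ^+ 2 / (1 + t ^+ 2)).
  by field; exact: sqrD1_neq0.
have D0 : 0 < 1 + t ^+ 2 by rewrite ltr_pwDl // sqr_ge0.
have t2 : 0 <= 2 * t ^+ 2 by rewrite mulr_ge0 // sqr_ge0.
rewrite normrN ger0_norm ?(divr_ge0 t2 (ltW D0)) //.
by rewrite ler_pdivrMr // ler_peMr // lerDl sqr_ge0.
Qed.

Let eq_norm_le (a b : R) : a = b -> `|a| <= `|b|.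
Proof. by move=> ->. Qed.

(** First-order Taylor expansion along a rotation, with a remainder uniform over the sphere. As
    [rotation_field i j] is a derivation, it suffices to treat constants and variables and to pass
    to sums and products. *)
Lemma meval_rotate_expansion i j p : i != j ->
  exists2 C : R, 0 <= C & forall t x, `|t| <= 1 -> sphere x ->
  `|ev p (rotate i j t x) - ev p x - 2 * t * ev (rotation_field i j p) x|
    <= C * t ^+ 2.
Proof.
move=> ij; have ji : (j == i) = false by rewrite eq_sym; exact: negbTE.
elim/mpoly_ring_ind: p => [c|k|p q [B B0 pB] [C C0 qC]|p q [B B0 pB] [C C0 qC]].
- exists 0 => // t x _ _; rewrite /rotation_field !mderivC !mulr0 subrr meval0.
  by rewrite !mevalC subrr mulr0 subrr normr0 mul0r.
(* Coordinates are at most 1 on the sphere, so the sine and the cosine each contribute an error of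
   at most 2 t^2. *)
- exists 4 => // t x t1 Sx.
  rewrite /rotation_field !mderiv_var mevalB !mevalM !mevalXU !rmorph_nat.
  have x1 k' : `|x ord0 k'| <= 1 by exact: norm_coord_sphere.
  set c1 := (1 - t ^+ 2) / (1 + t ^+ 2) - 1.
  set s1 := 2 * t - 2 * t / (1 + t ^+ 2).
  have bound a b : `|a| <= 1 -> `|b| <= 1 -> `|c1 * a + s1 * b| <= 4 * t ^+ 2.
    move=> a1 b1; have -> : 4 * t ^+ 2 = 2 * t ^+ 2 + 2 * t ^+ 2 by ring.
    rewrite (le_trans (ler_normD _ _)) // !normrM lerD //.
      by rewrite -[leRHS]mulr1 ler_pM // norm_1_sub_cos.
    by rewrite -[leRHS]mulr1 ler_pM // norm_sin_sub.
  have [->|ki] := eqVneq k i.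
    rewrite ji !mulr0n mulr1n rotate_fst //.
    apply: le_trans (bound (x ord0 i) (x ord0 j) (x1 _) (x1 _)).
    by apply: eq_norm_le; rewrite /c1 /s1; ring.
  have [->|kj] := eqVneq k j.
    rewrite !mulr0n mulr1n rotate_snd //.
    have := bound (x ord0 j) (- x ord0 i); rewrite normrN => /(_ (x1 _) (x1 _)).
    apply: le_trans.
    by apply: eq_norm_le; rewrite /c1 /s1; ring.
  rewrite rotate_other // !mulr0n.
  by rewrite subrr !mulr0 subrr mulr0 subrr normr0 mulr_ge0 ?sqr_ge0.
- exists (B + C); first exact: addr_ge0.
  move=> t x t1 Sx; rewrite [leRHS]mulrDl.
  apply: le_trans (lerD (pB t x t1 Sx) (qC t x t1 Sx)).
  apply: le_trans (ler_normD _ _); apply: eq_norm_le.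
  by rewrite /rotation_field !mderivD !(mevalB, mevalM, mevalD); ring.
have [Bp Bp0 pBp] := meval_sphere_bounded p.
have [Bq Bq0 qBq] := meval_sphere_bounded q.
have [Dp Dp0 pDp] := meval_sphere_bounded (rotation_field i j p).
have [Dq Dq0 qDq] := meval_sphere_bounded (rotation_field i j q).
(* One summand for each term of the identity below; [Bp + 2 * Dp] bounds the linear part of the
   expansion of p for |t| at most 1. *)
exists (B * Bq + (Bp + 2 * Dp) * C + 4 * (Dp * Dq)).
  by rewrite !(addr_ge0, mulr_ge0).
move=> t x t1 Sx; set y := rotate i j t x.
have Sy : sphere y by rewrite sphere_rotate.
(* The remainder of a product: those of p and q with bounded factors, plus the t^2 term from
   multiplying the two linear parts. *)
have -> : ev (p * q) y - ev (p * q) x - 2 * t * ev (rotation_field i j (p * q)) x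
  = (ev p y - ev p x - 2 * t * ev (rotation_field i j p) x) * ev q y
  + (ev p x + 2 * t * ev (rotation_field i j p) x) *
    (ev q y - ev q x - 2 * t * ev (rotation_field i j q) x)
  + t ^+ 2 * (4 * (ev (rotation_field i j p) x * ev (rotation_field i j q) x)).
  by rewrite /rotation_field !mderivM !(mevalB, mevalM, mevalD); ring.
rewrite [leRHS]mulrDl [X in _ <= X + _]mulrDl (le_trans (ler_normD _ _)) // lerD //.
  rewrite (le_trans (ler_normD _ _)) // lerD // normrM.
    by rewrite [leRHS]mulrAC; apply: ler_pM => //; [exact: pB|exact: qBq].
  rewrite -[leRHS]mulrA; apply: ler_pM => //; last exact: qC.
  rewrite (le_trans (ler_normD _ _)) // lerD ?pBp // -mulrA normrM ger0_norm //.
  rewrite ler_pM2l // normrM -[leRHS]mul1r.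
  by apply: ler_pM => //; exact: pDp.
rewrite mulrC normrM [X in _ * X]ger0_norm ?sqr_ge0 // ler_wpM2r ?sqr_ge0 //.
rewrite normrM ger0_norm // ler_pM2l // normrM.
by apply: ler_pM => //; [exact: pDp|exact: qDq].
Qed.

(** Integrating the expansion, rotation invariance cancels the terms of order zero, so |2 t I| is at
    most K t^2 for |t| at most 1; a small t then forces I = 0. *)
Lemma poly_int_rotation_field i j p : poly_int (rotation_field i j p) = 0.
Proof.
have [<-|ij] := eqVneq i j; first by rewrite /rotation_field subrr linear0.
have [C C0 pC] := meval_rotate_expansion p ij.
have [B _ pB] := meval_sphere_bounded p.
set I := poly_int _; pose K := C * sphere_area R d.
have K0 : 0 <= K by rewrite mulr_ge0 // sphere_area_ge0.
have IK t : `|t| <= 1 -> `|2 * t * I| <= K * t ^+ 2.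
  move=> t1.
  have intR : (@surface_measure R d).-integrable sphere
      (EFin \o (fun x => ev p (rotate i j t x))).
    apply: (@sphere_integrable _ _ _ B).
      apply: measurable_funTS.
      exact: (measurableT_comp (measurable_meval p) (measurable_rotate i j t)).
    by move=> x Sx; rewrite pB // sphere_rotate.
  have E : sphere_int (fun x => ev p (rotate i j t x) -
      ev (p + (2 * t) *: rotation_field i j p) x) = - (2 * t * I).
    rewrite /sphere_int RintegralB //; first last.
    - exact: meval_integrable.
    - exact: measurable_sphere.
    rewrite -/(sphere_int (fun x => ev p (rotate i j t x))).
    rewrite -/(sphere_int (fun x => ev (p + (2 * t) *: rotation_field i j p) x)).
    rewrite (sphere_int_rotate _ ij (measurable_meval p) pB).
    rewrite -/(poly_int p) -/(poly_int (p + (2 * t) *: rotation_field i j p)).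
    by rewrite linearD linearZ /= -/I opprD addrA subrr add0r.
  rewrite -normrN -E /K mulrAC; apply: norm_sphere_int_le.
    apply: measurable_funTS; apply: measurable_funB; last exact: measurable_meval.
    exact: (measurableT_comp (measurable_meval p) (measurable_rotate i j t)).
  by move=> x Sx; rewrite mevalD mevalZ opprD addrA; exact: pC.
apply/eqP; rewrite -normr_eq0 eq_le normr_ge0 andbT leNgt; apply/negP => I0.
have D0 : 0 < `|I| + K by rewrite ltr_pwDl.
(* An explicit small t: s lies in (0, 1] and s K = |I| - s |I| is less than |I|, which contradicts
   [IK s]. *)
pose s := `|I| / (`|I| + K).
have s0 : 0 < s by rewrite divr_gt0.
have sE : s * `|I| + s * K = `|I| by rewrite -mulrDr divfK // gt_eqF.
have s1 : `|s| <= 1 by rewrite (ger0_norm (ltW s0)) /s ler_pdivrMr // mul1r lerDl.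
have s2 : 0 <= 2 * s by rewrite mulr_ge0 // ltW.
have := IK s s1; rewrite normrM (ger0_norm s2).
have -> : 2 * s * `|I| = s * (2 * `|I|) by ring.
have -> : K * s ^+ 2 = s * (s * K) by ring.
rewrite ler_pM2l //; have : 0 < s * `|I| by rewrite mulr_gt0.
lra.
Qed.

Lemma poly_int_harmonic_orthogonal k l p q : (1 <= d)%N ->
  harmonic_poly k p -> harmonic_poly l q ->
  k != l -> poly_int (p * q) = 0.
Proof.
by move=> d1 hp hq kl;
  exact: (harmonic_orthogonal poly_int_rotation_field d1 hp hq kl).
Qed.

End polynomials_on_sphere.

(** * Measurability and boundedness of continuous functions *)

Section rowv_topology.
Variable R : realType.

Lemma bigcup_countType_measurable d (T : measurableType d) (I : countType)
    (F : I -> set T) :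
  (forall i, measurable (F i)) -> measurable (\bigcup_i F i).
Proof.
move=> mF; pose G k := if unpickle k is Some i then F i else set0.
rewrite (_ : \bigcup_i F i = \bigcup_k G k).
  by apply: bigcup_measurable => k _; rewrite /G; case: unpickle.
apply/seteqP; split => [x [i _ Fix]|x [k _]].
  by exists (pickle i) => //; rewrite /G pickleK.
by rewrite /G; case: unpickle => // i Fix; exists i.
Qed.

(** The sigma-algebra is generated by the coordinates, so the open set is written as a countable
    union of boxes with rational centres and half-widths 1/(k+1). *)
Lemma open_measurable_rowv n (A : set 'rV[R]_n) : open A -> measurable A.
Proof.
move=> oA.
pose box (c : 'rV[rat]_n * nat) : set 'rV[R]_n :=
  \bigcap_(i in [set: 'I_n]) ((fun x : 'rV[R]_n => x ord0 i) @^-1`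
     [set` `](ratr (c.1 ord0 i) - c.2.+1%:R^-1),
             (ratr (c.1 ord0 i) + c.2.+1%:R^-1)[%R]).
(* Boxes not contained in [A] are replaced by the empty set, so the union ranges over a whole
   countable type. *)
pose F c := if pselect (box c `<=` A) then box c else set0.
rewrite (_ : A = \bigcup_c F c).
  apply: bigcup_countType_measurable => c; rewrite /F; case: pselect => /= _ //.
  apply: fin_bigcap_measurable => [|i _]; first exact: finite_finset.
  by apply: measurable_preimageT (measurable_coor i) _; exact: measurable_itv.
apply/seteqP; split => [x Ax|x [c _]]; last first.
  by rewrite /F; case: pselect => /= [cA|//]; exact: cA.
have /nbhs_ballP[e /= e0 xeA] : nbhs x A by exact: open_nbhs_nbhs.
(* Two points of a box of half-width below e / 2 are at distance less than e. *)
have [k ke] : exists k : nat, k.+1%:R^-1 < e / 2.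
  have e2 : 0 < e / 2 by rewrite divr_gt0.
  have [k _ /(_ k (leqnn k))] := near_infty_natSinv_lt (PosNum e2).
  by exists k.
have : 0 < k.+1%:R^-1 :> R by rewrite invr_gt0.
set r : R := k.+1%:R^-1 in ke * => r0.
have qP i : exists q : rat, ratr q \in `](x ord0 i - r), (x ord0 i + r)[.
  by apply: rat_in_itvoo; lra.
pose q : 'rV[rat]_n := \row_i sval (cid (qP i)).
have qE i : x ord0 i - r < ratr (q ord0 i) < x ord0 i + r.
  by rewrite mxE; case: cid => s /=; rewrite in_itv.
exists (q, k) => //; rewrite /F; case: pselect => /= [_|[]].
  move=> i _; rewrite /= in_itv /= -/r.
  by have /andP[qi iq] := qE i; rewrite ltrBlDr iq -ltrBlDr qi.
move=> y yb; apply: xeA; split => // i j; rewrite (ord1 i) /ball /= ltr_norml.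
have := yb j Logic.I; rewrite /= in_itv /= -/r; have := qE j; move: ke.
move: (ratr _) (x _ j) (y _ j) (r) => a b c s se /andP[? ?] /andP[? ?].
by apply/andP; split; lra.
Qed.

Lemma within_continuous_measurable_rowv n (D : set 'rV[R]_n) (f : 'rV[R]_n -> R) :
  measurable D -> {within D, continuous f} -> measurable_fun D f.
Proof.
move=> mD /continuousP cf; apply: (measurability _ (RGenOpens.measurableE R)).
move=> _ [_ [a [b ->] <-]].
have /open_subspaceP[U oU UD] : open (from_subspace D f @^-1` `]a, b[%classic).
  exact/cf/interval_open.
by rewrite setIC -UD; apply: measurableI => //; exact: open_measurable_rowv.
Qed.

End rowv_topology.

(** * Compactness of the sphere and boundedness of continuous functions *)

Section sphere_topology.
Variables (R : realType) (d : nat).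
Local Notation V := 'rV[R]_d.+1.
Implicit Types (f : V -> R).

Lemma compact_sphere : compact (@sphere R d).
Proof.
apply: bounded_closed_compact.
  exists 1; split; first exact: num_real.
  move=> M M1 x Sx; apply: le_trans (ltW M1); rewrite [leLHS]/Num.norm /= mx_normrE.
  by apply/bigmax_leP; split => // -[i j] _ /=; rewrite (ord1 i) norm_coord_sphere.
have cq : continuous (@sqnorm R d).
  apply: continuous_big => [|i _ x]; first exact: add_continuous.
  apply: (@continuous_comp _ _ _ (fun x : V => x ord0 i) (fun y => y ^+ 2)).
    exact: coord_continuous.
  exact: exprn_continuous.
apply: (@preimage_closed _ _ (@sqnorm R d) [set x | x = 1]); last exact: closed_eq.
by move=> x _; exact: cq.
Qed.

Lemma sphere_continuous_bounded f : {within sphere, continuous f} ->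
  exists B : R, forall x, sphere x -> `|f x| <= B.
Proof.
move=> cf; have := continuous_compact cf compact_sphere.
move=> /compact_bounded[M [_ fM]]; exists (M + 1) => x Sx.
by apply: (fM (M + 1)); [rewrite ltrDl|exists x].
Qed.

End sphere_topology.

(** * Hyperinterpolation *)

Section sphere_L2.
Variables (R : realType) (d : nat).
Local Notation V := 'rV[R]_d.+1.
Implicit Types (x : V) (f g : V -> R) (B : R).

Lemma eq_sphere_int f g : (forall x, sphere x -> f x = g x) ->
  sphere_int f = sphere_int g.
Proof. by move=> fg; apply: eq_Rintegral => x; rewrite inE => /fg. Qed.

Lemma sphere_neq0 : exists x : V, sphere x.
Proof.
exists (delta_mx ord0 ord0); rewrite /sphere /= /sqnorm (bigD1 ord0) //= big1.
  by rewrite mxE !eqxx expr1n addr0.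
by move=> i i0; rewrite mxE eqxx (negbTE i0) expr0n.
Qed.

(** Passes from the extended-real norm to a real integral; the bound C provides integrability of the
    square. *)
Lemma sphere_L2norm_le f B : measurable_fun sphere f -> 0 <= B ->
  (exists C : R, forall x, sphere x -> `|f x| <= C) ->
  sphere_int (fun x => f x ^+ 2) <= B ^+ 2 -> (sphere_L2norm f <= B%:E)%E.
Proof.
move=> mf B0 [C fC] fB.
have mf2 : measurable_fun sphere (fun x => f x ^+ 2) by exact: measurable_funX.
have int2 : (@surface_measure R d).-integrable sphere (EFin \o (fun x => f x ^+ 2)).
  apply: (@sphere_integrable _ _ _ (C ^+ 2)) => // x Sx.
  by rewrite normrX lerXn2r ?nnegrE ?(le_trans _ (fC x Sx)) // fC.
rewrite /sphere_L2norm unlock.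
have -> : (\int[@surface_measure R d]_x `|(EFin \o f \_ sphere) x| `^ 2
   = (sphere_int (fun x => f x ^+ 2))%:E)%E.
  rewrite /sphere_int /Rintegral fineK; last first.
    by apply: integrable_fin_num => //; exact: measurable_sphere.
  rewrite [RHS]integral_mkcond; apply: eq_integral => x _ /=.
  rewrite /patch; case: ifPn => _ /=; last by rewrite normr0 powR0.
  by rewrite powR_mulrn // real_normK // num_real.
rewrite poweR_EFin lee_fin powR12_sqrt; last first.
  by apply: Rintegral_ge0 => x _; exact: sqr_ge0.
by rewrite -(ger0_norm B0) -sqrtr_sqr ler_wsqrtr.
Qed.

Lemma sphere_L2norm_leB f g : measurable_fun sphere f -> measurable_fun sphere g ->
  (sphere_L2norm (fun x => f x - g x)%R <= sphere_L2norm f + sphere_L2norm g)%E.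
Proof.
move=> mf mg; rewrite /sphere_L2norm.
have mS := @measurable_sphere R d.
have mfS : measurable_fun setT (f \_ sphere) by apply/(measurable_restrictT _ mS).
have mgS : measurable_fun setT (g \_ sphere) by apply/(measurable_restrictT _ mS).
have -> : (EFin \o ((fun x => f x - g x) \_ sphere) =
    EFin \o ((f \_ sphere) \+ (\- (g \_ sphere))))%R.
  by apply/funext => x /=; rewrite /patch; case: ifPn => // _; rewrite subr0.
have -> : Lnorm (@surface_measure R d) 2%:E (EFin \o (g \_ sphere)) =
   Lnorm (@surface_measure R d) 2%:E (EFin \o (\- (g \_ sphere)))%R.
  by rewrite -oppe_Lnorm; apply: eq_Lnorm => x /=; rewrite EFinN.
apply: minkowski_EFin => //; last by rewrite ler1n.
exact: measurableT_comp.
Qed.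

(** Boundedness is assumed because the real-valued [sup] is a true supremum only for sets bounded
    above. *)
Lemma sphere_supnorm_ub f : (exists B, forall x, sphere x -> `|f x| <= B) ->
  forall x, sphere x -> `|f x| <= sphere_supnorm f.
Proof.
move=> [B fB] x Sx; apply: ub_le_sup; last by exists x.
by exists B => _ [y Sy <-]; exact: fB.
Qed.

End sphere_L2.

(** * Degrees and harmonic components of polynomials on the sphere *)

Section sphere_polynomials.
Variables (R : realType) (d : nat).
Local Notation V := 'rV[R]_d.+1.
Local Notation P := (mpoly d.+1 R).
Local Notation ev p x := (meval (x ord0) p).
Implicit Types (x : V) (f g : V -> R) (p q : P).

Lemma msize_dhomog_le l p : p \is ishomog1 l mdeg -> (msize p <= l.+1)%N.
Proof.
move=> /dhomogP hp; rewrite msizeE; apply/bigmax_leqP_seq => m pm _.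
by have := hp m pm => /= ->.
Qed.

Lemma msize_sum_leq (I : finType) (F : I -> P) n :
  (forall i, (msize (F i) <= n)%N) -> (msize (\sum_i F i) <= n)%N.
Proof.
move=> Fn; apply: (big_ind (fun p : P => (msize p <= n)%N)) => // [|p q pn qn].
  by rewrite msize0.
by apply: leq_trans (msizeD_le _ _) _; rewrite geq_max pn.
Qed.

Lemma msizeM_leq n m p q : (msize p <= n.+1)%N -> (msize q <= m.+1)%N ->
  (msize (p * q) <= (n + m).+1)%N.
Proof.
(* [msize] is the degree plus one, except that it is 0 at the zero polynomial, which is treated
   apart. *)
move=> pn qm; have [->|p0] := eqVneq p 0; first by rewrite mul0r msize0.
have [->|q0] := eqVneq q 0; first by rewrite mulr0 msize0.
rewrite msizeM //.
by have := leq_add pn qm; rewrite addSn addnS; case: (_ + _)%N.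
Qed.

Lemma meval_r2_sphere x : sphere x -> ev (r2 R d) x = 1.
Proof.
move=> <-; rewrite /r2 raddf_sum; apply: eq_bigr => i _.
by rewrite /= expr2 mevalM mevalXU.
Qed.

Lemma harmonic_poly0 l : harmonic_poly l (0 : P).
Proof. by split; [exact: rpred0|rewrite linear0]. Qed.

Lemma harmonic_polyD l p q :
  harmonic_poly l p -> harmonic_poly l q -> harmonic_poly l (p + q).
Proof.
by move=> [hp lp] [hq lq]; split; [exact: rpredD|rewrite linearD /= lp lq addr0].
Qed.

(** Each homogeneous component is a sum of terms [r2 ^+ j * h] with h harmonic of no larger degree,
    and [r2] is 1 on the sphere. *)
Lemma sphere_harmonic_decomposition n p : (msize p <= n.+1)%N ->
  exists h : nat -> P, (forall l, harmonic_poly l (h l)) /\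
    forall x, sphere x -> ev p x = \sum_(l < n.+1) ev (h l) x.
Proof.
move=> pn.
pose Q p := exists h : nat -> P, (forall l, harmonic_poly l (h l)) /\
    forall x, sphere x -> ev p x = \sum_(l < n.+1) ev (h l) x.
have Q0 : Q 0.
  exists (fun=> 0); split => [l|x _]; first exact: harmonic_poly0.
  by rewrite meval0 big1 // => l _; rewrite meval0.
have QD a b : Q a -> Q b -> Q (a + b).
  move=> [h [hh ah]] [k [hk bk]]; exists (fun l => h l + k l); split => [l|x Sx].
    exact: harmonic_polyD.
  rewrite mevalD ah // bk // -big_split.
  by apply: eq_bigr => l _; rewrite mevalD.
rewrite -/(Q p) (pihomog_partitionE pn).
apply: big_ind => // l _; have := pihomogP mdeg l p.
move: (pihomog _ _ _); apply: harmonic_decomposition_ind => // j k h jk hh.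
exists (fun l' => if l' == k then h else 0); split => [l'|x Sx].
  by case: eqP => [->|_]; [|exact: harmonic_poly0].
have kn : (k < n.+1)%N.
  by apply: leq_ltn_trans (ltn_ord l); rewrite -jk leq_addl.
rewrite mevalM rmorphXn /= meval_r2_sphere // expr1n mul1r.
rewrite (bigD1 (Ordinal kn)) //= eqxx big1 ?addr0 // => i ik.
by rewrite ifN ?meval0 //; apply: contraNneq ik => ik; apply/eqP/val_inj.
Qed.

End sphere_polynomials.

(** * Fourier coefficients of hyperinterpolants and reproduction of polynomials *)

Section hyperinterpolation_estimates.
Variables (R : realType) (d : nat).
Local Notation V := 'rV[R]_d.+1.
Local Notation P := (mpoly d.+1 R).
Local Notation ev p x := (meval (x ord0) p).
Variables (m : nat) (xs : 'I_m -> V) (w : 'I_m -> R).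
Variables (Z : nat -> nat) (Y : forall l : nat, 'I_(Z l) -> V -> R).
Hypothesis d_gt0 : (0 < d)%N.
Hypothesis xsS : forall j, sphere (xs j).
Hypothesis basisY :
  forall l, sphere_orthonormal_basis (@spherical_harmonic R d l) (@Y l).
Implicit Types (f g : V -> R) (x : V) (p : P) (l n : nat).

Local Notation D := (discrete_inner w xs).
Local Notation U := (hyperinterpolant w xs Y).

Let Ypoly l (k : 'I_(Z l)) : exists p : P, harmonic_poly l p /\
  forall x, sphere x -> Y k x = ev p x.
Proof. by have [/(_ k)[p [hp lp Yp]] _ _] := basisY l; exists p. Qed.

(** A harmonic polynomial chosen to represent [Y k], so that products and integrals can be handled
    through the linear form [poly_int]. *)
Let y l (k : 'I_(Z l)) : P := sval (cid (Ypoly k)).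

Let harmonic_y l (k : 'I_(Z l)) : harmonic_poly l (y k).
Proof. by have [] := svalP (cid (Ypoly k)). Qed.

Let yE l (k : 'I_(Z l)) x : sphere x -> Y k x = ev (y k) x.
Proof. by have [_] := svalP (cid (Ypoly k)); exact. Qed.

Let msize_y l (k : 'I_(Z l)) : (msize (y k) <= l.+1)%N.
Proof. by apply: msize_dhomog_le; case: (harmonic_y k). Qed.

Let y_orthonormal l (k k' : 'I_(Z l)) : poly_int (y k * y k') = (k == k')%:R.
Proof.
have [_ <- _] := basisY l; apply: eq_sphere_int => x Sx.
by rewrite mevalM !yE.
Qed.

(** The spanning property yields some coefficients, and orthonormality identifies them with the
    integrals. *)
Let harmonic_expansion l p : harmonic_poly l p ->
  forall x, sphere x -> ev p x = \sum_(k < Z l) poly_int (p * y k) * ev (y k) x.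
Proof.
move=> [hp lp]; have [_ _ /(_ (fun x => ev p x))[]] := basisY l.
  by exists p.
move=> c pc x Sx; rewrite pc //; apply: eq_bigr => k _; rewrite yE //.
congr (_ * _).
have -> : poly_int (p * y k) = poly_int ((\sum_(k' < Z l) c k' *: y k') * y k).
  apply: eq_sphere_int => z Sz; rewrite !mevalM pc // raddf_sum; congr (_ * _).
  by apply: eq_bigr => k' _; rewrite /= mevalZ yE.
rewrite mulr_suml linear_sum (bigD1 k) //= -scalerAl linearZ /=.
rewrite y_orthonormal eqxx mulr1 big1 ?addr0 // => k' k'k.
by rewrite -scalerAl linearZ /= y_orthonormal (negbTE k'k) mulr0.
Qed.

Let hyperpoly n f : P := \sum_(l < n.+1) \sum_(k < Z l) D f (Y k) *: y k.

Let hyperpolyE n f x : sphere x -> U n f x = ev (hyperpoly n f) x.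
Proof.
move=> Sx; rewrite /hyperinterpolant raddf_sum; apply: eq_bigr => l _ /=.
by rewrite raddf_sum; apply: eq_bigr => k _ /=; rewrite mevalZ yE.
Qed.

Let msize_hyperpoly n f : (msize (hyperpoly n f) <= n.+1)%N.
Proof.
apply: msize_sum_leq => l; apply: msize_sum_leq => k.
by apply: leq_trans (msizeZ_le _ _) _; apply: leq_trans (msize_y k) _; exact: ltn_ord.
Qed.

Lemma hyperinterpolant_sphere_poly n f : sphere_poly n (U n f).
Proof. by exists (hyperpoly n f) => // x; exact: hyperpolyE. Qed.

(** Terms of other degrees vanish by orthogonality of harmonics, those of the same degree by
    orthonormality of the basis. *)
Let poly_int_hyperpoly n f l (k : 'I_(Z l)) : (l < n.+1)%N ->
  poly_int (hyperpoly n f * y k) = D f (Y k).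
Proof.
move=> ln; rewrite /hyperpoly mulr_suml linear_sum.
rewrite (bigD1 (Ordinal ln)) //= [X in _ + X]big1 ?addr0 => [|l' l'l].
  rewrite mulr_suml linear_sum (bigD1 k) //= -scalerAl linearZ /=.
  rewrite y_orthonormal eqxx mulr1 big1 ?addr0 // => k' k'k.
  by rewrite -scalerAl linearZ /= y_orthonormal (negbTE k'k) mulr0.
rewrite mulr_suml linear_sum big1 // => k' _; rewrite -scalerAl linearZ /=.
rewrite (poly_int_harmonic_orthogonal d_gt0 (harmonic_y k') (harmonic_y k)) ?mulr0 //.
Qed.

(** Both sides are the sum of the squares of [D f (Y k)]: the left by Parseval, the right by
    linearity of the discrete product in its second argument. *)
Lemma sphere_int_hyperinterpolant_sqr n f :
  sphere_int (fun x => U n f x ^+ 2) = D f (U n f).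
Proof.
transitivity (poly_int (hyperpoly n f * hyperpoly n f)).
  by apply: eq_sphere_int => x Sx; rewrite hyperpolyE // mevalM expr2.
rewrite {2}/hyperpoly mulr_sumr linear_sum /=.
transitivity (\sum_(l < n.+1) \sum_(k < Z l) D f (Y k) * D f (Y k)).
  apply: eq_bigr => l _; rewrite mulr_sumr linear_sum; apply: eq_bigr => k _ /=.
  by rewrite -scalerAr linearZ /= poly_int_hyperpoly.
have DE a b : D a b = \sum_j w j * a (xs j) * b (xs j) by [].
rewrite [RHS]DE /hyperinterpolant.
under [RHS]eq_bigr do rewrite mulr_sumr.
rewrite exchange_big; apply: eq_bigr => l _ /=.
under [RHS]eq_bigr do rewrite mulr_sumr.
rewrite [RHS]exchange_big; apply: eq_bigr => k _ /=.
rewrite [X in _ * X = _]DE mulr_sumr; apply: eq_bigr => j _; ring.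
Qed.

(** For degree l at most n, the product of chi and [Y l k] has degree at most n + n', so exactness
    makes the discrete coefficients of chi its true Fourier coefficients. Orthogonality then leaves
    the degree l component of chi. *)
Lemma hyperinterpolant_reproducing n n' chi : (n' <= n)%N ->
  (forall g, sphere_poly (n + n') g ->
    \sum_(j < m) w j * g (xs j) = sphere_int g) ->
  sphere_poly n' chi -> forall x, sphere x -> U n chi x = chi x.
Proof.
move=> n'n exact [p pn' chip] x Sx; rewrite chip //.
have [h [hh ph]] :=
  sphere_harmonic_decomposition (leq_trans pn' (n'n : n' < n.+1)%N).
rewrite ph // /hyperinterpolant; apply: eq_bigr => l _.
rewrite (harmonic_expansion (hh l) Sx); apply: eq_bigr => k _; rewrite yE //.
congr (_ * _); rewrite /discrete_inner.
transitivity (poly_int (p * y k)).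
  transitivity (\sum_j w j * ev (p * y k) (xs j)).
    by apply: eq_bigr => j _; rewrite mevalM -mulrA chip ?yE.
  apply: (exact (fun x => ev (p * y k) x)); exists (p * y k) => //.
  rewrite addnC; apply: msizeM_leq => //; apply: leq_trans (msize_y k) _.
  exact: ltn_ord.
have -> : poly_int (p * y k) = poly_int ((\sum_(l' < n.+1) h l') * y k).
  by apply: eq_sphere_int => z Sz; rewrite !mevalM ph // raddf_sum.
rewrite mulr_suml linear_sum (bigD1 l) //= big1 ?addr0 // => l' l'l.
exact: poly_int_harmonic_orthogonal d_gt0 (hh l') (harmonic_y k) l'l.
Qed.

End hyperinterpolation_estimates.

Section sphere_poly_regularity.
Variables (R : realType) (d : nat).
Implicit Types (f : 'rV[R]_d.+1 -> R).

Lemma sphere_poly_measurable n f : sphere_poly n f -> measurable_fun sphere f.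
Proof.
move=> [p _ fp]; apply: (eq_measurable_fun (fun x : 'rV[R]_d.+1 => meval (x ord0) p)).
  by move=> x; rewrite inE => Sx; rewrite fp.
by apply: measurable_funTS; exact: measurable_meval.
Qed.

Lemma sphere_poly_bounded n f : sphere_poly n f ->
  exists B : R, forall x, sphere x -> `|f x| <= B.
Proof.
move=> [p _ fp]; have [B _ pB] := meval_sphere_bounded p.
by exists B => x Sx; rewrite fp // pB.
Qed.

Lemma sphere_poly_cst n (c : R) : sphere_poly n (fun _ : 'rV[R]_d.+1 => c).
Proof.
exists (mpolyC d.+1 c) => [|x _]; last by rewrite mevalC.
by rewrite msizeC; case: (c == 0).
Qed.

End sphere_poly_regularity.

(** * Stability of hyperinterpolation and the error bound for a fixed polynomial *)

Section hyperinterpolation_error.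
Variables (R : realType) (d n n' m : nat).
Local Notation V := 'rV[R]_d.+1.
Variables (xs : 'I_m -> V) (w : 'I_m -> R) (eta : R).
Variables (Z : nat -> nat) (Y : forall l : nat, 'I_(Z l) -> V -> R).
Hypothesis d_gt0 : (0 < d)%N.
Hypothesis n'_le_n : (n' <= n)%N.
Hypothesis xsS : forall j, sphere (xs j).
Hypothesis w_gt0 : forall j, 0 < w j.
Hypothesis basisY :
  forall l, sphere_orthonormal_basis (@spherical_harmonic R d l) (@Y l).
Hypothesis eta_ge0 : 0 <= eta.
Hypothesis MZ : forall chi, sphere_poly n chi ->
    `|\sum_(j < m) w j * chi (xs j) ^+ 2 - sphere_int (fun x => chi x ^+ 2)|
      <= eta * sphere_int (fun x => chi x ^+ 2).
Hypothesis exact : forall g, sphere_poly (n + n') g ->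
    \sum_(j < m) w j * g (xs j) = sphere_int g.
Implicit Types (f g chi : V -> R) (x : V).

Local Notation D := (discrete_inner w xs).
Local Notation U := (hyperinterpolant w xs Y n).

Lemma sum_weights : \sum_(j < m) w j = sphere_area R d.
Proof.
have := exact (sphere_poly_cst d (n + n') (1 : R)).
under eq_bigr do rewrite mulr1; move=> ->.
by rewrite /sphere_int Rintegral_cst ?mul1r //; exact: measurable_sphere.
Qed.

(* Young's inequality with weight 1 + eta replaces Cauchy-Schwarz in bounding
   <Ug, Ug> = <g, Ug>_m. *)
Lemma hyperinterpolant_stable g (M : R) : (forall x, sphere x -> `|g x| <= M) ->
  sphere_int (fun x => U g x ^+ 2) <= (1 + eta) * (M ^+ 2 * sphere_area R d).
Proof.
move=> gM; set A := sphere_int _.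
have e0 : 0 < 1 + eta by rewrite ltr_pwDl.
have AD : A = D g (U g) by exact: sphere_int_hyperinterpolant_sqr.
have UA : \sum_(j < m) w j * U g (xs j) ^+ 2 <= (1 + eta) * A.
  have := MZ (hyperinterpolant_sphere_poly xs w basisY n g).
  by rewrite -/A ler_norml => /andP[_]; lra.
have gA : \sum_(j < m) w j * g (xs j) ^+ 2 <= M ^+ 2 * sphere_area R d.
  rewrite -sum_weights mulr_sumr; apply: ler_sum => j _.
  rewrite mulrC ler_wpM2r ?(ltW (w_gt0 j)) // -[leLHS]real_normK ?num_real //.
  by rewrite lerXn2r ?nnegrE ?gM // (le_trans _ (gM _ (xsS j))).
(* At each node the difference of the two sides is the weight times the square of (1 + eta) a -
   b. *)
have young : (1 + eta) * (A *+ 2) <=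
    (1 + eta) ^+ 2 * (\sum_(j < m) w j * g (xs j) ^+ 2)
    + \sum_(j < m) w j * U g (xs j) ^+ 2.
  rewrite AD /discrete_inner -sumrMnl !mulr_sumr -big_split.
  apply: ler_sum => j _ /=; rewrite -subr_ge0.
  set a := g _; set b := U g _.
  have -> : (1 + eta) ^+ 2 * (w j * a ^+ 2) + w j * b ^+ 2
     - (1 + eta) * ((w j * a * b) *+ 2) = w j * ((1 + eta) * a - b) ^+ 2 by ring.
  by rewrite mulr_ge0 ?sqr_ge0 // ltW.
(* The discrete norm of U g contributes at most (1 + eta) A, which is absorbed into the left side 2
   (1 + eta) A. *)
have : (1 + eta) * A <= (1 + eta) * ((1 + eta) * (M ^+ 2 * sphere_area R d)).
  have : (1 + eta) ^+ 2 * (\sum_(j < m) w j * g (xs j) ^+ 2)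
      <= (1 + eta) ^+ 2 * (M ^+ 2 * sphere_area R d).
    by rewrite ler_wpM2l // sqr_ge0.
  move: young UA; rewrite mulr2n mulrDr expr2 -mulrA; lra.
by rewrite ler_pM2l.
Qed.

Lemma hyperinterpolation_error_le f chi :
  measurable_fun sphere f -> (exists B : R, forall x, sphere x -> `|f x| <= B) ->
  sphere_poly n' chi ->
  (sphere_L2norm (fun x => U f x - f x)%R
    <= ((Num.sqrt (1 + eta) + 1) * Num.sqrt (sphere_area R d)
         * sphere_supnorm (fun x => f x - chi x)%R)%R%:E)%E.
Proof.
move=> mf [B fB] chiP; pose g x := f x - chi x; set M := sphere_supnorm _.
have [C chiC] := sphere_poly_bounded chiP.
have mg : measurable_fun sphere g.
  by apply: measurable_funB => //; exact: sphere_poly_measurable chiP.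
have gB : exists B' : R, forall x, sphere x -> `|g x| <= B'.
  exists (B + C) => x Sx.
  by rewrite (le_trans (ler_normB _ _)) // lerD ?fB ?chiC.
have gM : forall x, sphere x -> `|g x| <= M := sphere_supnorm_ub gB.
have M0 : 0 <= M.
  by have [x Sx] := sphere_neq0 R d; exact: le_trans (normr_ge0 _) (gM x Sx).
have UgP := hyperinterpolant_sphere_poly xs w basisY n g.
have Uf x : sphere x -> U f x - f x = U g x - g x.
  move=> Sx; have Uchi :=
    hyperinterpolant_reproducing d_gt0 xsS basisY n'_le_n exact chiP Sx.
  (* The hyperinterpolant is additive in the function, and f = g + chi. *)
  suff -> : U f x = U g x + U chi x by rewrite Uchi /g; ring.
  rewrite -big_split; apply: eq_bigr => l _; rewrite -big_split.
  apply: eq_bigr => k _ /=; rewrite -mulrDl; congr (_ * _).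
  by rewrite -big_split; apply: eq_bigr => j _; rewrite /g /=; ring.
have -> : sphere_L2norm (fun x => U f x - f x)
    = sphere_L2norm (fun x => U g x - g x).
  apply: eq_Lnorm => x /=; rewrite /patch; case: ifPn => //.
  by rewrite inE => /Uf ->.
apply: le_trans (sphere_L2norm_leB (sphere_poly_measurable UgP) mg) _.
have a0 := sphere_area_ge0 R d; have e0 : 0 <= 1 + eta by rewrite addr_ge0.
(* The summand with sqrt (1 + eta) bounds the norm of U g, the other one the norm of g. *)
rewrite mulrDl mul1r mulrDl EFinD; apply: leeD.
  have mUg := sphere_poly_measurable UgP.
  apply: (sphere_L2norm_le mUg _ (sphere_poly_bounded UgP)).
    by rewrite !mulr_ge0 ?sqrtr_ge0.
  rewrite !exprMn !sqr_sqrtr // -mulrA [_ * M ^+ 2]mulrC.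
  exact: hyperinterpolant_stable.
apply: sphere_L2norm_le => //; first by rewrite mulr_ge0 ?sqrtr_ge0.
rewrite exprMn sqr_sqrtr // mulrC.
have mg2 : measurable_fun sphere (fun x => g x ^+ 2) by exact: measurable_funX.
apply: le_trans (ler_norm _) _; apply: norm_sphere_int_le => // x Sx.
by rewrite normrX lerXn2r ?nnegrE ?gM.
Qed.

End hyperinterpolation_error.

Theorem mainTheorem4 (R : realType) (d n n' m : nat)
    (xs : 'I_m -> 'rV[R]_d.+1) (w : 'I_m -> R) (eta : R)
    (Z : nat -> nat) (Y : forall l : nat, 'I_(Z l) -> 'rV[R]_d.+1 -> R) :
  (2 <= d)%N ->
  (0 < n' <= n)%N ->
  (forall j, sphere (xs j)) ->
  (forall j, 0 < w j) ->
  (forall l, sphere_orthonormal_basis (@spherical_harmonic R d l) (Y l)) ->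
  0 <= eta < 1 ->
  (forall chi, sphere_poly n chi ->
    `|\sum_(j < m) w j * chi (xs j) ^+ 2 - sphere_int (fun x => chi x ^+ 2)|
      <= eta * sphere_int (fun x => chi x ^+ 2)) ->
  (forall g, sphere_poly (n + n') g ->
    \sum_(j < m) w j * g (xs j) = sphere_int g) ->
  forall f : 'rV[R]_d.+1 -> R, {within sphere, continuous f} ->
    (sphere_L2norm (fun x => hyperinterpolant w xs Y n f x - f x)%R
      <= ((Num.sqrt (1 + eta) + 1) * Num.sqrt (sphere_area R d)
           * best_approx n' f)%R%:E)%E.
Proof.
move=> d2 /andP[_ n'n] xsS w0 basisY /andP[eta0 _] MZ exact f cf.
have mf := within_continuous_measurable_rowv (@measurable_sphere R d) cf.
have fB := sphere_continuous_bounded cf.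
set c := (_ + 1) * _; set L := sphere_L2norm _.
have c0 : 0 <= c by rewrite mulr_ge0 ?addr_ge0 ?sqrtr_ge0.
have Lle chi : sphere_poly n' chi ->
    (L <= (c * sphere_supnorm (fun x => f x - chi x)%R)%:E)%E.
  exact: (hyperinterpolation_error_le (ltnW d2) n'n xsS w0 basisY eta0 MZ exact
            mf fB).
have P0 := sphere_poly_cst d n' (0 : R).
(* The bound with chi = 0 shows that the norm is finite, so the infimum can be taken among reals. *)
have Lfin : L \is a fin_num.
  by rewrite ge0_fin_numE ?Lnorm_ge0 // (le_lt_trans (Lle _ P0)) // ltry.
rewrite -(fineK Lfin) lee_fin.
have {}Lle chi : sphere_poly n' chi ->
    fine L <= c * sphere_supnorm (fun x => f x - chi x).
  by move=> /Lle; rewrite -{1}(fineK Lfin) lee_fin.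
(* If c = 0, the bound with chi = 0 already concludes. Otherwise, dividing by c makes the norm over
   c a lower bound of a set that is nonempty, again by chi = 0. *)
move: c0; rewrite le_eqVlt => /predU1P[c0|c0].
  by have := Lle _ P0; rewrite -c0 !mul0r.
rewrite -ler_pdivrMl //; apply: lb_le_inf.
  by exists (sphere_supnorm (fun x => f x - 0)), (fun=> 0).
by move=> _ [chi chiP <-]; rewrite ler_pdivrMl // Lle.
Qed.
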